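(* Let $s\in\mathbb{N}$, $(n,k,l)\in\mathbb{N}^3$ with $l<k$, and set $m:=\lceil\log_2(k-l)\rceil$. Then \[{\rm Nim}(\mathcal{C}_s(\mathcal{KG}(n,k,l)))=\left(\binom{n\bmod 2^m}{k\bmod 2^m}\bmod 2\right)\cdot{\rm Nim}(\mathcal{C}_s(\mathcal{K}_t)),\qquad t=\binom{\lfloor n/2^m\rfloor}{\lfloor k/2^m\rfloor}.\]
   Context: Chomp on a finite poset $P$ with global minimum $0$: two players alternately pick an element $x$ of the remaining poset and remove all elements $\ge x$; the player forced to pick $0$ loses. ${\rm Nim}(\{0\})=0$ and ${\rm Nim}(P)=\mathrm{mex}\{{\rm Nim}(P_x) : x\in P\setminus\{0\}\}$, where $P_x$ is $P$ with the up-set of $x$ removed. For $(n,k,l)\in\mathbb{N}\times\mathbb{Z}^2$, $\mathcal{KG}(n,k,l)$ has as vertices the $k$-element subsets of $\{1,\dots,n\}$, two distinct vertices adjacent iff the sets intersect in at most $l$ elements. $\mathcal{K}_t$ is the complete graph on $t$ vertices. For a graph $G$ and $s\in\mathbb{N}$, $\mathcal{C}_s(G)$ is the simplicial complex on $V(G)$ whose faces are the cliques of size at most $s$ (including the empty face), ordered by inclusion. Binomial coefficients $\binom{a}{b}$ with $b>a$ are $0$. *)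

(* Defs.v *)
From HB Require Import structures.
From mathcomp Require Import all_boot all_order.

Set Implicit Arguments.
Unset Strict Implicit.
Unset Printing Implicit Defensive.

Import Order.TTheory Order.DefaultSetSubsetOrder.

Lemma mex_proof (s : seq nat) : exists n, n \notin s.
Proof.
exists (\max_(i <- s) i).+1; apply/negP => /seq_tnthP[j e].
have : tnth (in_tuple s) j <= \max_(i <- s) i.
  by apply: leq_bigmax_seq => //; exact: mem_tnth.
by rewrite -e ltnn.
Qed.

Definition mex (s : seq nat) : nat := ex_minn (mex_proof s).

Section Chomp.
Variables (d : Order.disp_t) (T : finBPOrderType d).
Implicit Types (P : {set T}) (x : T).

(* A position is a subset P of T containing \bot, with the induced order, so   *)
(* \bot is the global minimum of P.                                            *)
Definition chomp P x : {set T} := [set y in P | ~~ (x <= y)%O].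

(* Each move shrinks the position, so #|P| is enough fuel; NimE is the defining *)
(* recursion of the Nim value.                                                 *)
Fixpoint Nim_rec (fuel : nat) P : nat :=
  if fuel is fuel'.+1 then
    mex [seq Nim_rec fuel' (chomp P x) | x <- enum (P :\ \bot%O)]
  else 0.

Definition Nim P : nat := Nim_rec #|P| P.

Lemma chomp_proper P x : x \in P -> chomp P x \proper P.
Proof.
move=> Px; apply/properP; split; first by apply/subsetP => y; rewrite inE => /andP[].
by exists x => //; rewrite inE lexx andbF.
Qed.

Lemma Nim_rec_set0 fuel : Nim_rec fuel set0 = 0.
Proof.
case: fuel => //= f; rewrite set0D enum_set0 /= /mex.
by case: ex_minnP => m _ /(_ 0 isT); case: m.
Qed.

Lemma Nim_rec_fuel f g P : #|P| <= f -> #|P| <= g -> Nim_rec f P = Nim_rec g P.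
Proof.
elim: f g P => [|f IH] g P lef leg.
  by move: lef; rewrite leqn0 cards_eq0 => /eqP->; rewrite !Nim_rec_set0.
case: g leg => [|g] leg.
  by move: leg; rewrite leqn0 cards_eq0 => /eqP->; rewrite !Nim_rec_set0.
rewrite /=; congr mex; apply/eq_in_map => x.
rewrite mem_enum => /setD1P[_ /chomp_proper /proper_card lt].
by apply: IH; rewrite -ltnS; apply: leq_trans lt _.
Qed.

Lemma NimE P : Nim P = mex [seq Nim (chomp P x) | x <- enum (P :\ \bot%O)].
Proof.
rewrite /Nim (@Nim_rec_fuel _ #|P|.+1) //=; congr mex; apply/eq_in_map => x.
rewrite mem_enum => /setD1P[_ /chomp_proper /proper_card /ltnW lt].
exact: Nim_rec_fuel.
Qed.

End Chomp.

Record sgraph := SGraph {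
  vertex :> finType;
  adj : rel vertex;
  adj_sym : symmetric adj;
  adj_irr : irreflexive adj
}.

Definition clique (G : sgraph) (F : {set G}) : bool :=
  [forall x in F, forall y in F, (x != y) ==> adj x y].

(* Order.DefaultSetSubsetOrder orders {set G} by inclusion, with \bot = set0.  *)
Definition clique_complex (s : nat) (G : sgraph) : {set {set G}} :=
  [set F : {set G} | clique F & #|F| <= s].

Section KG.
Variables n k l : nat.

(* {1, ..., n} is encoded as 'I_n.                                             *)
Definition kset : finType := {A : {set 'I_n} | #|A| == k}.

Definition KG_adj : rel kset :=
  [rel A B | (A != B) && (#|val A :&: val B| <= l)].

Lemma KG_adj_sym : symmetric KG_adj.
Proof. by move=> A B; rewrite /KG_adj /= eq_sym setIC. Qed.

Lemma KG_adj_irr : irreflexive KG_adj.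
Proof. by move=> A; rewrite /KG_adj /= eqxx. Qed.

Definition KG : sgraph := SGraph KG_adj_sym KG_adj_irr.

End KG.

Section CompleteGraph.
Variable t : nat.

Definition complete_adj : rel 'I_t := [rel i j | i != j].

Lemma complete_adj_sym : symmetric complete_adj.
Proof. by move=> i j; rewrite /complete_adj /= eq_sym. Qed.

Lemma complete_adj_irr : irreflexive complete_adj.
Proof. by move=> i; rewrite /complete_adj /= eqxx. Qed.

Definition complete_graph : sgraph := SGraph complete_adj_sym complete_adj_irr.

End CompleteGraph.

(* Main.v *)
Require Import Defs.
From mathcomp Require Import all_boot all_order perm zify.
Import Order.DefaultSetSubsetOrder.

(** If an order-preserving involution of a poset has a down-closed set of fixed
points, then the Nim value of the poset is that of the fixed points.  For a
clique complex this applies to every graph involution that never moves a vertex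
to an adjacent one, and it restricts the graph to the fixed vertices.

Put c = k - l, so that two k-sets A, B are adjacent iff |A \ B| >= c.  If c > 1,
a transposition of the ground set moves no k-set to an adjacent one.  Applying
the transpositions of floor(n/2) disjoint pairs in turn leaves the k-sets that
are unions of pairs, plus the leftover point when n and k are odd; there are
none if k is odd and n even.  These form the same graph with parameters
(floor(n/2), floor(k/2), ceil(c/2)).  After m such steps c = 1 and the graph is
complete; the parity conditions met on the way are those of Lucas' theorem. *)

Set Implicit Arguments.
Unset Strict Implicit.
Unset Printing Implicit Defensive.

Import Order.TTheory.

(** * Nim values of posets: options, involutions, embeddings *)

Lemma mexP (s : seq nat) (v : nat) :
  v \notin s -> (forall w, w < v -> w \in s) -> mex s = v.
Proof.
move=> vNs lt_v; rewrite /mex; case: ex_minnP => u uNs /(_ _ vNs) le_uv.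
by apply/eqP; rewrite eqn_leq le_uv leqNgt; apply: contraNN uNs => /lt_v.
Qed.

Lemma mex_notin (s : seq nat) : mex s \notin s.
Proof. by rewrite /mex; case: ex_minnP. Qed.

Lemma mem_lt_mex (s : seq nat) (w : nat) : w < mex s -> w \in s.
Proof.
rewrite /mex; case: ex_minnP => u _ min_u; apply: contraLR => /min_u.
by rewrite -leqNgt.
Qed.

Section NimTheory.
Variables (d : Order.disp_t) (T : finBPOrderType d).
Implicit Types (P : {set T}) (x : T).

Lemma Nim_option P x :
  x \in P -> x != \bot%O -> Nim (chomp P x) != Nim P.
Proof.
move=> Px xN0; apply/eqP => eqN.
have := mex_notin [seq Nim (chomp P y) | y <- enum (P :\ \bot%O)].
by rewrite -NimE -eqN (map_f (fun y => Nim (chomp P y))) // mem_enum !inE xN0.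
Qed.

Lemma Nim_lt_option P w : w < Nim P ->
  exists x, [/\ x \in P, x != \bot%O & Nim (chomp P x) = w].
Proof.
rewrite NimE => /mem_lt_mex/mapP[x]; rewrite mem_enum !inE => /andP[xN0 Px] ->.
by exists x.
Qed.

Lemma eq_Nim P v :
    (forall x, x \in P -> x != \bot%O -> Nim (chomp P x) != v) ->
    (forall w, w < v ->
       exists x, [/\ x \in P, x != \bot%O & Nim (chomp P x) = w]) ->
  Nim P = v.
Proof.
move=> ne_v lt_v; rewrite NimE; apply: mexP.
  apply/mapP => -[x]; rewrite mem_enum !inE => /andP[xN0 Px] eq_v.
  by have /eqP[] := ne_v _ Px xN0.
move=> w /lt_v[x [Px xN0 <-]].
by rewrite (map_f (fun y => Nim (chomp P y))) // mem_enum !inE xN0.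
Qed.

Lemma Nim_bot : Nim [set \bot%O : T] = 0.
Proof. by apply: eq_Nim => // x; rewrite inE => /eqP->; rewrite eqxx. Qed.

(* A move at a non-fixed x is answered by the move at f x, which restores
   invariance under f and, the fixed points being a down-set, removes none of
   them. *)
Lemma Nim_involution (f : T -> T) P :
    involutive f -> {homo f : x y / (x <= y)%O} ->
    {in P, forall x, f x \in P} ->
    {in P &, forall x y, (x <= y)%O -> f y = y -> f x = x} ->
  Nim P = Nim [set x in P | f x == x].
Proof.
move=> fK f_homo.
have f_mono x y : (f x <= f y)%O = (x <= y)%O.
  by apply/idP/idP => [/f_homo|/f_homo //]; rewrite !fK.
have f_bot : f \bot%O = \bot%O.
  by apply/eqP; rewrite -lex0 -[leRHS]fK f_mono le0x.
have [c] := ubnP #|P|; elim: c P => // c IH P; rewrite ltnS => le_Pc fP downP.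
(* Applying [f] to [x <= f x] gives [f x <= x]. Hence after a move at a non-fixed [x] the reply
   [f x] is still available. *)
have le_f x : (x <= f x)%O -> f x = x.
  by move=> le_xfx; apply: le_anti; rewrite le_xfx andbT -[leRHS]fK f_mono.
have chomp_fix x : x \in P -> f x = x ->
    Nim (chomp P x) = Nim (chomp [set y in P | f y == y] x).
  move=> Px fx; rewrite IH.
  - by congr Nim; apply/setP => y; rewrite !inE andbAC.
  - exact: leq_trans (proper_card (chomp_proper Px)) le_Pc.
  - by move=> y; rewrite !inE => /andP[/fP-> Nxy]; rewrite -fx f_mono.
  by move=> y z /setIdP[Py _] /setIdP[Pz _]; apply: downP.
(* Moves at fixed points already reach every smaller value; it remains that no move reaches the
   value of the fixed part itself. *)
apply: eq_Nim => [x Px xN0|w /Nim_lt_option[x []]]; last first.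
  by rewrite inE => /andP[Px /eqP fx] xN0 <-; exists x; rewrite chomp_fix.
have [fx|/eqP fxNx] := eqVneq (f x) x.
  by rewrite chomp_fix // Nim_option // inE Px fx eqxx.
pose Q := chomp (chomp P x) (f x).
have Pfx : f x \in chomp P x.
  by rewrite inE fP //=; apply/negP => /le_f.
have QE y : (y \in Q) = [&& y \in P, ~~ (x <= y)%O & ~~ (f x <= y)%O].
  by rewrite !inE andbA.
have NimQ : Nim Q = Nim [set y in P | f y == y].
  rewrite IH.
  - congr Nim; apply/setP => y; rewrite [in LHS]inE QE [in RHS]inE.
    case: (boolP (y \in P)) => //= Py; apply: andb_idl => /eqP fy.
    rewrite -{2}fy f_mono andbb; apply/negP => le_xy.
    exact/fxNx/(downP _ _ Px Py).
  - apply: leq_trans (proper_card (chomp_proper Pfx)) _.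
    exact: ltnW (leq_trans (proper_card (chomp_proper Px)) le_Pc).
  - move=> y; rewrite !QE => /and3P[/fP-> Nxy Nfxy] /=.
    by rewrite f_mono Nxy andbT -{1}(fK x) f_mono.
  by move=> y z; rewrite !QE => /and3P[Py _ _] /and3P[Pz _ _]; apply: downP.
(* [Q] has the target value and is an option of [chomp P x], which therefore has another value. *)
rewrite -NimQ eq_sym Nim_option // -f_bot (inj_eq (can_inj fK)) //.
Qed.

End NimTheory.

(** By induction, [f] carries the options of [P] to those of [f @: P]; the condition on [\bot]
    matches the excluded moves. *)
Lemma Nim_embedding (d d' : Order.disp_t) (T : finBPOrderType d)
    (T' : finBPOrderType d') (f : T -> T') (P : {set T}) :
    {in P &, {mono f : x y / (x <= y)%O}} ->
    {in P, forall x, (f x == \bot%O) = (x == \bot%O)} ->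
  Nim (f @: P) = Nim P.
Proof.
have [c] := ubnP #|P|; elim: c P => // c IH P; rewrite ltnS => le_Pc.
move=> f_mono f_bot.
have chompE x : x \in P -> Nim (chomp (f @: P) (f x)) = Nim (chomp P x).
  move=> Px; rewrite -IH.
  - congr Nim; apply/setP => y; rewrite inE; apply/andP/imsetP.
      case=> /imsetP[z Pz ->]; rewrite f_mono // => Nxz.
      by exists z; rewrite // inE Pz.
    case=> z; rewrite inE => /andP[Pz Nxz] ->.
    by rewrite imset_f // f_mono.
  - exact: leq_trans (proper_card (chomp_proper Px)) le_Pc.
  - by move=> y z /setIdP[Py _] /setIdP[Pz _]; apply: f_mono.
  by move=> y /setIdP[Py _]; apply: f_bot.
apply: eq_Nim => [y /imsetP[x Px ->]|w /Nim_lt_option[x [Px xN0 <-]]].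
  by rewrite f_bot // => xN0; rewrite chompE // Nim_option.
by exists (f x); rewrite imset_f // f_bot // chompE.
Qed.

(** * Clique complexes and maps of graphs *)

Lemma leEset (X : finType) (A B : {set X}) : (A <= B)%O = (A \subset B).
Proof. by []. Qed.

(** Stands for the clique complex of the subgraph induced on [U], keeping one vertex type while
    vertices are discarded. *)
Definition clique_complex_on (s : nat) (G : sgraph) (U : {set G}) :
  {set {set G}} := [set F in clique_complex s G | F \subset U].

Section CliqueComplex.
Variable s : nat.
Implicit Types G H : sgraph.

Lemma cliqueP G (F : {set G}) :
  reflect {in F &, forall x y, x != y -> adj x y} (clique F).
Proof.
apply: (iffP forall_inP) => [F_cl x y Fx Fy xNy|F_cl x Fx].
  exact: (implyP (forall_inP (F_cl x Fx) y Fy)).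
by apply/forall_inP => y Fy; apply/implyP; apply: F_cl.
Qed.

Lemma clique_complex_onT G : clique_complex_on s [set: G] = clique_complex s G.
Proof. by apply/setP => F; rewrite inE subsetT andbT. Qed.

Lemma Nim_clique_complex_on0 G : Nim (clique_complex_on s (set0 : {set G})) = 0.
Proof.
rewrite -[RHS](Nim_bot {set G}); congr Nim; apply/setP => F.
rewrite !inE subset0 andb_idl // => /eqP->; rewrite cards0 andbT.
by apply/cliqueP => x; rewrite inE.
Qed.

(** Taking images of faces is an order embedding under which only the empty face becomes empty, so
    [Nim_embedding] applies. *)
Lemma Nim_clique_complex_embedding G H (f : H -> G) (W : {set H}) :
    {in W &, injective f} -> {in W &, {mono f : x y / adj x y}} ->
  Nim (clique_complex_on s (f @: W)) = Nim (clique_complex_on s W).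
Proof.
move=> f_inj f_adj.
have cliqueE (F : {set H}) : F \subset W -> clique (f @: F) = clique F.
  move=> /subsetP sFW; apply/cliqueP/cliqueP => F_cl.
    move=> x y Fx Fy xNy; rewrite -f_adj ?sFW // F_cl ?imset_f //.
    by apply: contraNneq xNy => /f_inj->; rewrite ?sFW.
  move=> _ _ /imsetP[x Fx ->] /imsetP[y Fy ->] fxNfy.
  by rewrite f_adj ?sFW // F_cl //; apply: contraNneq fxNfy => ->.
have cardE (F : {set H}) : F \subset W -> #|f @: F| = #|F|.
  move=> /subsetP sFW; apply: card_in_imset => x y /sFW Wx /sFW.
  exact: f_inj.
rewrite -(@Nim_embedding _ _ {set H} {set G} (fun F : {set H} => f @: F)).
- congr Nim; apply/setP => F; rewrite !inE; apply/andP/imsetP.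
    case=> /andP[F_cl leFs] /subsetP sFW; pose E := [set x in W | f x \in F].
    have sEW : E \subset W by apply/subsetP => x /setIdP[].
    have eqF : F = f @: E.
      apply/setP => y; apply/idP/imsetP => [Fy|[x /setIdP[_ Fx] -> //]].
      have /imsetP[x Wx eq_y] := sFW _ Fy.
      by exists x; rewrite // inE Wx -eq_y.
    exists E => //.
    by rewrite !inE -cliqueE // -cardE // -eqF F_cl leFs.
  case=> E; rewrite !inE => /andP[/andP[E_cl leEs] sEW] ->.
  by rewrite cliqueE // cardE // E_cl leEs imsetS.
- move=> E F; rewrite !inE => /andP[_ /subsetP sEW] /andP[_ /subsetP sFW].
  rewrite !leEset; apply/idP/idP => [/subsetP sEF|/imsetS//].
  apply/subsetP => x Ex.
  have /imsetP[y Fy /f_inj->] := sEF _ (imset_f f Ex) => //.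
    exact: sEW.
  exact: sFW.
by move=> F _; rewrite imset_eq0.
Qed.

(** A face fixed by [f] is fixed pointwise: a moved vertex [x] would share a clique with [f x],
    hence be adjacent to it. So the fixed faces form a down-set, as [Nim_involution] requires. *)
Lemma Nim_clique_complex_involution G (f : G -> G) (U : {set G}) :
    involutive f -> {mono f : x y / adj x y} -> {in U, forall x, f x \in U} ->
    {in U, forall x, f x != x -> ~~ adj x (f x)} ->
  Nim (clique_complex_on s U) =
  Nim (clique_complex_on s [set x in U | f x == x]).
Proof.
move=> fK f_adj fU f_nadj; have f_inj := can_inj fK.
have imfK : involutive (fun F : {set G} => f @: F).
  by move=> F; rewrite -imset_comp (eq_imset _ fK) imset_id.
have fix_face (F : {set G}) : F \in clique_complex_on s U -> f @: F = F ->
    {in F, forall x, f x = x}.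
  rewrite !inE => /andP[/andP[/cliqueP F_cl _] /subsetP sFU] fF x Fx.
  apply/eqP; apply: contraTT (Fx) => fxNx; have Ux := sFU _ Fx.
  have := f_nadj x Ux fxNx; rewrite F_cl ?[x == _]eq_sym //.
  by rewrite -fF imset_f.
have imf_id (F : {set G}) : {in F, forall x, f x = x} -> f @: F = F.
  by move=> F_id; rewrite (eq_in_imset F_id) imset_id.
rewrite (@Nim_involution _ {set G} (fun F : {set G} => f @: F)) //.
- congr Nim; apply/setP => F; rewrite [in LHS]inE.
  apply/andP/idP => [[ccF /eqP fF]|].
    have F_id := fix_face _ ccF fF; move: ccF; rewrite !inE.
    move=> /andP[-> /subsetP sFU]; apply/subsetP => x Fx.
    by rewrite inE sFU //= F_id.
  rewrite !inE => /andP[-> /subsetP sFU]; split.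
    by apply/subsetP => x /sFU/setIdP[].
  by apply/eqP/imf_id => x /sFU/setIdP[_ /eqP].
- by move=> E F; rewrite !leEset => /imsetS->.
- move=> F; rewrite !inE card_imset //.
  move=> /andP[/andP[/cliqueP F_cl ->] /subsetP sFU]; rewrite andbT.
  apply/andP; split.
    apply/cliqueP => _ _ /imsetP[x Fx ->] /imsetP[y Fy ->].
    by rewrite (inj_eq f_inj) f_adj; apply: F_cl.
  by apply/subsetP => _ /imsetP[x /sFU Ux ->]; apply: fU.
move=> E F _ ccF; rewrite leEset => /subsetP sEF fF; apply: imf_id => x /sEF.
exact: fix_face.
Qed.

End CliqueComplex.

(** * Lucas' theorem modulo 2, one binary digit at a time *)

Lemma odd_bin_half (n k : nat) :
  odd 'C(n, k) = odd 'C(n./2, k./2) && (odd k ==> odd n).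
Proof.
have even_top h j : odd 'C(h.*2, j) = odd 'C(h, j./2) && ~~ odd j.
  elim: h j => [|h IH] j; first by case: j => [|[|j]]; rewrite // andbF.
  case: j => [|[|j]]; first by rewrite !bin0.
    by rewrite bin1 odd_double bin0 andbF.
  (* Pascal's rule applied twice counts the middle term twice, so it cancels modulo 2. *)
  rewrite doubleS [in RHS]/= !binS !oddD !IH /= !negbK.
  by case: (odd j) (odd 'C(h, j./2)) (odd 'C(h, j./2.+1)) (odd 'C(h, uphalf j))
    => [] [] [] [].
rewrite -{1}[n]odd_double_half; case: (odd n); last first.
  by rewrite add0n even_top implybF.
rewrite add1n implybT andbT; case: k => [|k]; first by rewrite !bin0.
(* For odd [n], only the Pascal term with even lower index can be odd. *)
by rewrite binS oddD !even_top /= negbK uphalf_half; case: (odd k);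
  rewrite ?andbT ?andbF ?addbF.
Qed.

(** * Kneser graphs in terms of set differences *)

Section DifferenceGraph.
Variables (X : finType) (c : nat).

(** Bounding both differences makes the relation symmetric on sets of all sizes; for sets of equal
    size the two bounds agree. *)
Definition diff_adj : rel {set X} :=
  [rel A B | [&& A != B, c <= #|A :\: B| & c <= #|B :\: A|]].

Lemma diff_adj_sym : symmetric diff_adj.
Proof. by move=> A B; rewrite /diff_adj /= eq_sym andbA andbAC -andbA. Qed.

Lemma diff_adj_irr : irreflexive diff_adj.
Proof. by move=> A; rewrite /diff_adj /= eqxx. Qed.

(* On the sets of a fixed size k, this is KG(n, k, k - c): bounding differences
   rather than intersections makes the parameter c independent of k. *)
Definition diff_graph : sgraph := SGraph diff_adj_sym diff_adj_irr.

Definition layer (k : nat) : {set diff_graph} := [set A : {set X} | #|A| == k].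

End DifferenceGraph.

Lemma imset_setD (X Y : finType) (f : X -> Y) (A B : {set X}) :
  injective f -> f @: (A :\: B) = f @: A :\: f @: B.
Proof.
move=> f_inj; apply/setP => y; rewrite inE; apply/imsetP/andP.
  by case=> x; rewrite inE => /andP[xNB Ax] ->; rewrite !mem_imset.
case=> fxNB /imsetP[x Ax eq_y]; exists x => //.
by rewrite inE Ax -(mem_imset _ _ f_inj) -eq_y fxNB.
Qed.

Lemma card_setD_layer (X : finType) (A B : {set X}) :
  #|A| = #|B| -> #|A :\: B| = #|B :\: A|.
Proof. by move=> eqAB; rewrite !cardsD setIC eqAB. Qed.

Section NimLayer.
Variable s : nat.

(** Lets ['I_n] be replaced by a ground set made of pairs and a leftover point. *)
Lemma Nim_layer_card (X Y : finType) (c k : nat) : #|X| = #|Y| ->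
  Nim (clique_complex_on s (layer X c k)) =
  Nim (clique_complex_on s (layer Y c k)).
Proof.
move=> eqXY; pose g (x : X) : Y := enum_val (cast_ord eqXY (enum_rank x)).
have g_inj : injective g.
  by move=> x y /enum_val_inj/cast_ord_inj/enum_rank_inj.
have [h hK gK] : bijective g by apply: inj_card_bij; rewrite ?eqXY.
pose f (A : {set X}) := g @: A.
rewrite -(@Nim_clique_complex_embedding s (diff_graph Y c) (diff_graph X c) f).
- congr (Nim (clique_complex_on s _)); apply/setP => B; rewrite inE.
  apply/imsetP/eqP => [[A]|cardB].
    by rewrite inE => /eqP <- ->; rewrite card_imset.
  exists (h @: B); first by rewrite inE card_imset ?cardB //; apply: can_inj gK.
  by rewrite /f -imset_comp (eq_imset _ gK) imset_id.
- by move=> A B _ _; apply: imset_inj.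
move=> A B _ _ /=; rewrite /diff_adj /= (inj_eq (imset_inj g_inj)).
by rewrite -!imset_setD // !card_imset.
Qed.

(** Of two distinct sets of equal size neither contains the other, so for c = 1 all distinct k-sets
    are adjacent. *)
Lemma Nim_layer_complete (X : finType) (k : nat) :
  Nim (clique_complex_on s (layer X 1 k)) =
  Nim (clique_complex s (complete_graph 'C(#|X|, k))).
Proof.
have cardL : #|layer X 1 k| = 'C(#|X|, k).
  rewrite -cardsT -cards_draws; apply: eq_card => A.
  by rewrite !inE subsetT.
pose f (i : complete_graph 'C(#|X|, k)) : diff_graph X 1 :=
  enum_val (cast_ord (esym cardL) i).
have f_inj : injective f by move=> i j /enum_val_inj/cast_ord_inj.
rewrite -clique_complex_onT -(@Nim_clique_complex_embedding s _ _ f).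
- congr (Nim (clique_complex_on s _)); apply/setP => A.
  apply/idP/imsetP => [LA|[i _ ->]]; last exact: enum_valP.
  exists (cast_ord cardL (enum_rank_in LA A)) => //.
  by rewrite /f cast_ordK enum_rankK_in.
- by move=> i j _ _; apply: f_inj.
move=> i j _ _ /=; rewrite /diff_adj /complete_adj /= (inj_eq f_inj).
case: (eqVneq i j) => //= iNj.
have cardf u : #|f u| = k.
  by have := enum_valP (cast_ord (esym cardL) u); rewrite inE => /eqP.
rewrite -card_setD_layer ?cardf // andbb card_gt0 setD_eq0.
apply: contraNN iNj => sub_ji; rewrite eq_sym -(inj_eq f_inj) eqEcard sub_ji /=.
by rewrite !cardf.
Qed.

(** For k-sets the difference has k minus the size of the intersection as its size. *)
Lemma Nim_KG (n k l : nat) : l <= k ->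
  Nim (clique_complex s (KG n k l)) =
  Nim (clique_complex_on s (layer 'I_n (k - l) k)).
Proof.
move=> le_lk; pose f (A : KG n k l) : diff_graph 'I_n (k - l) := val A.
rewrite -clique_complex_onT -(@Nim_clique_complex_embedding s _ _ f).
- congr (Nim (clique_complex_on s _)); apply/setP => A; rewrite inE.
  apply/imsetP/idP => [[B _ ->]|cardA]; first exact: (valP B).
  by exists (Sub A cardA).
- by move=> A B _ _; apply: val_inj.
move=> A B _ _ /=; rewrite /diff_adj /KG_adj /= (inj_eq val_inj).
case: (A != B) => //=; have [/eqP cardA /eqP cardB] := (valP A, valP B).
rewrite -card_setD_layer /f ?cardA ?cardB // andbb cardsD cardB setIC.
rewrite leq_sub2lE //; apply: leq_trans (subset_leq_card (subsetIl _ _)) _.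
by rewrite cardA.
Qed.

End NimLayer.

(** * Halving the ground set by transpositions *)

Section Halving.
Variable s : nat.

Lemma mem_imset_tperm (X : finType) (a b : X) (A : {set X}) (x : X) :
  (x \in tperm a b @: A) = (tperm a b x \in A).
Proof. by rewrite -{1}[x](tpermK a b) mem_imset //; apply: perm_inj. Qed.

(* A set A not fixed by the transposition (a b) contains exactly one of a, b,
   so it differs from its image in one element and is not adjacent to it. *)
Lemma Nim_layer_tperm (X : finType) (c : nat) (U : {set diff_graph X c})
    (a b : X) : 1 < c ->
    {in U, forall A : {set X}, tperm a b @: A \in U} ->
  Nim (clique_complex_on s U) =
  Nim (clique_complex_on s [set A : diff_graph X c in U |
         (a \in (A : {set X})) == (b \in (A : {set X}))]).
Proof.
move=> c_gt1 fU; pose g := tperm a b; have g_inj : injective g := @perm_inj _ g.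
pose f (A : {set X}) := g @: A.
have memf (A : {set X}) x : (x \in f A) = (g x \in A).
  exact: mem_imset_tperm.
have fK : involutive f by move=> A; apply/setP => x; rewrite !memf tpermK.
have fix_f A : (f A == A) = ((a \in A) == (b \in A)).
  apply/eqP/eqP => [fA|eqAab].
    by rewrite -{1}fA memf tpermL.
  by apply/setP => x; rewrite memf /g; case: tpermP => // ->.
rewrite (@Nim_clique_complex_involution s (diff_graph X c) f) //.
- by congr (Nim (clique_complex_on s _)); apply/setP => A; rewrite !inE fix_f.
- move=> A B /=; rewrite /diff_adj /= (inj_eq (imset_inj g_inj)).
  by rewrite -!imset_setD // !card_imset.
move=> A UA /= _; rewrite /diff_adj /=.
(* The difference lies in {a} if [A] contains [a], and in {b} otherwise. *)
suff le1 : #|A :\: f A| <= 1.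
  by rewrite [c <= _]leqNgt (leq_ltn_trans le1 c_gt1) andbF.
have [Aa|aNA] := boolP (a \in A).
  rewrite -(cards1 a); apply/subset_leq_card/subsetP => x.
  rewrite !inE memf /g; case: tpermP => [->|->|_ _]; rewrite ?eqxx //.
    by rewrite Aa.
  by case: (x \in A).
rewrite -(cards1 b); apply/subset_leq_card/subsetP => x.
rewrite !inE memf /g; case: tpermP => [->|->|_ _]; rewrite ?eqxx //.
  by rewrite (negPf aNA) andbF.
by case: (x \in A).
Qed.

Variables Y Z : finType.
(** Pairs of points indexed by [Y], and leftover points [Z]. *)
Let X : finType := ((Y * bool) + Z)%type.

Definition doubled (A : {set Y}) (B : {set Z}) : {set X} :=
  [set x | match x with inl p => p.1 \in A | inr z => z \in B end].

Lemma card_doubled A B : #|doubled A B| = #|A|.*2 + #|B|.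
Proof.
rewrite -sum1_card big_sumType /=; congr (_ + _); last first.
  by rewrite -sum1_card; apply: eq_bigl => z; rewrite inE.
rewrite (eq_bigl (mem (setX A [set: bool]))) => [|[y e]]; last first.
  by rewrite !inE andbT.
by rewrite sum1_card cardsX cardsT card_bool muln2.
Qed.

Lemma doubledD A A' B B' :
  doubled A B :\: doubled A' B' = doubled (A :\: A') (B :\: B').
Proof. by apply/setP => -[[y e]|z]; rewrite !inE. Qed.

Lemma doubled_inj B : injective (doubled^~ B).
Proof.
move=> A A' eqA; apply/setP => y.
by have /setP/(_ (inl (y, true))) := eqA; rewrite !inE.
Qed.

Definition twins (y : Y) (A : {set X}) : bool :=
  (inl (y, true) \in A) == (inl (y, false) \in A).

(** The pairs are swapped one at a time; [U r] holds the k-sets that survive once the pairs in [r]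
    are treated. *)
Lemma Nim_layer_twins (c k : nat) : 1 < c ->
  Nim (clique_complex_on s (layer X c k)) =
  Nim (clique_complex_on s
         [set A : diff_graph X c in layer X c k | [forall y, twins y A]]).
Proof.
move=> c_gt1.
pose U (r : seq Y) := [set A : diff_graph X c in layer X c k |
  all (twins^~ A) r].
have -> : [set A : diff_graph X c in layer X c k | [forall y, twins y A]] =
    U (enum Y).
  apply/setP => A; rewrite !inE; congr andb.
  apply/forallP/allP => [twA y _ //|twA y].
  by apply: twA; rewrite mem_enum.
elim: (enum Y) (enum_uniq Y) => [|y r IH] /=.
  move=> _; congr (Nim (clique_complex_on s _)); apply/setP => A.
  by rewrite !inE andbT.
move=> /andP[yNr /IH->].
rewrite (@Nim_layer_tperm _ _ _ (inl (y, true)) (inl (y, false))) //.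
  congr (Nim (clique_complex_on s _)); apply/setP => A; rewrite !inE /= -!andbA.
  by congr (_ && _); rewrite andbC.
set g := tperm _ _.
move=> A; rewrite !inE card_imset; last exact: perm_inj.
move=> /andP[-> /allP twA] /=.
apply/allP => y' ry'; have yNy' : y != y' by apply: contraNneq yNr => ->.
(* Pairs are disjoint, so the swap at [y] preserves the condition at [y']. *)
have gE e : g (inl (y', e)) = inl (y', e).
  by rewrite tpermD //; apply: contraNneq yNy' => -[->].
by rewrite /twins !mem_imset_tperm !gE; apply: twA.
Qed.

(** A surviving set is [doubled A' B] with [#|A'|.*2 + #|B| = k] and [#|B| <= 1], which forces both
    sizes. If [k] is odd and [Z] empty, no set survives and the value is 0. *)
Lemma Nim_layer_doubled (c k : nat) : 1 < c -> #|Z| <= 1 ->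
  Nim (clique_complex_on s (layer X c k)) =
  (odd k ==> (0 < #|Z|)) * Nim (clique_complex_on s (layer Y (uphalf c) k./2)).
Proof.
move=> c_gt1 leZ1; rewrite Nim_layer_twins //; set U := [set A in _ | _].
have decompose A : A \in U ->
    exists A' B, [/\ A = doubled A' B, #|A'| = k./2 & #|B| = odd k].
  rewrite !inE => /andP[/eqP cardA /forallP twA].
  pose A' := [set y | inl (y, true) \in A]; pose B := [set z | inr z \in A].
  have eqA : A = doubled A' B.
    apply/setP => -[[y []]|z]; rewrite !inE //=.
    by have /eqP := twA y.
  exists A', B; move: cardA (max_card B).
  rewrite [in #|A|]eqA card_doubled => <- leBZ.
  have : #|B| <= 1 by apply: leq_trans leBZ leZ1.
  by case: #|B| => [|[|//]] _; split => //; lia.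
have [kZ|] := boolP (odd k ==> (0 < #|Z|)); last first.
  rewrite negb_imply mul0n -leqNgt leqn0 => /andP[odd_k /eqP Z0].
  rewrite -(Nim_clique_complex_on0 s (diff_graph X c)).
  congr (Nim (clique_complex_on s _)); apply/setP => A; rewrite [RHS]inE.
  apply/negP => /decompose[A' [B [_ _ cardB]]].
  by have := max_card B; rewrite cardB odd_k Z0.
(* [E] is the only possible [B]: all of [Z] for odd [k], empty otherwise. *)
rewrite mul1n; pose E := [set z : Z | odd k].
have cardE : #|E| = odd k.
  rewrite /E; case: (odd k) kZ => /= kZ.
    by rewrite cardsT; apply/eqP; rewrite eqn_leq leZ1.
  by apply/eqP; rewrite cards_eq0; apply/eqP/setP => z; rewrite !inE.
pose f (A : diff_graph Y (uphalf c)) : diff_graph X c := doubled A E.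
rewrite -(@Nim_clique_complex_embedding s _ _ f).
- congr (Nim (clique_complex_on s _)); apply/setP => A; apply/idP/imsetP.
    case/decompose => A' [B [-> cardA' cardB]].
    exists A'; first by rewrite inE cardA'.
    congr doubled; apply/setP => z; rewrite inE.
    move: cardB; case: (odd k) => cardB.
      suff -> : B = setT by rewrite inE.
      by apply/eqP; rewrite eqEcard subsetT cardsT cardB.
    by rewrite (cards0_eq cardB) inE.
  case=> A'; rewrite !inE => /eqP cardA' ->.
  rewrite card_doubled cardA' cardE addnC odd_double_half eqxx /=.
  by apply/forallP => y; rewrite /twins !inE.
- by move=> A B _ _; apply: doubled_inj.
move=> A B _ _ /=; rewrite /diff_adj /= (inj_eq (@doubled_inj E)).
rewrite !doubledD !card_doubled setDv cards0 !addn0.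
(* Differences double in size, and [c <= d.*2] iff [uphalf c <= d]. *)
congr [&& _, _ & _]; lia.
Qed.

End Halving.

(** * Iterating the halving step *)

Lemma Nim_layer_half (s n c k : nat) : 1 < c ->
  Nim (clique_complex_on s (layer 'I_n c k)) =
  (odd k ==> odd n) *
  Nim (clique_complex_on s (layer 'I_(n./2) (uphalf c) k./2)).
Proof.
move=> c_gt1.
rewrite (@Nim_layer_card s _ (('I_n./2 * bool) + 'I_(odd n))%type).
  by rewrite Nim_layer_doubled // card_ord ?lt0b // leq_b1.
by rewrite card_sum card_prod card_bool !card_ord muln2 addnC odd_double_half.
Qed.

(** Strong induction on [c]: for [c > 1], passing to [uphalf c] lowers [up_log 2 c] by exactly
    one. *)
Lemma Nim_layer (s n c k : nat) : 0 < c ->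
  let m := up_log 2 c in
  Nim (clique_complex_on s (layer 'I_n c k)) =
    ('C(n %% 2 ^ m, k %% 2 ^ m) %% 2) *
    Nim (clique_complex s (complete_graph 'C(n %/ 2 ^ m, k %/ 2 ^ m))).
Proof.
elim/ltn_ind: c n k => -[//|[|c]] IH n k _ /=.
  (* Here m = 0, both residues are 0, and the binomial factor is ['C(0, 0) = 1]. *)
  by rewrite up_log1 !modn1 !divn1 mul1n Nim_layer_complete card_ord.
rewrite Nim_layer_half // IH //; last by rewrite /=; lia.
rewrite up_log2S //; set m := up_log 2 _.
have mod_half j : (j %% 2 ^ m.+1)./2 = j./2 %% 2 ^ m.
  by rewrite -!divn2 expnSr modn_divl.
have odd_mod_exp j : odd (j %% 2 ^ m.+1) = odd j by rewrite odd_mod // oddX.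
have div_half j : j %/ 2 ^ m.+1 = j./2 %/ 2 ^ m by rewrite expnS divnMA divn2.
rewrite !div_half mulnA; congr (_ * _).
(* The parity condition of the halving step is the lowest binary digit in Lucas' theorem. *)
by rewrite !modn2 (odd_bin_half (n %% _)) !mod_half !odd_mod_exp mulnb andbC.
Qed.

Theorem theorem2p14 (s n k l : nat) (hlk : l < k) :
  let m := up_log 2 (k - l) in
  let t := 'C(n %/ 2 ^ m, k %/ 2 ^ m) in
  Nim (clique_complex s (KG n k l)) =
    ('C(n %% 2 ^ m, k %% 2 ^ m) %% 2) * Nim (clique_complex s (complete_graph t)).
Proof. by rewrite /= Nim_KG ?Nim_layer ?subn_gt0 // ltnW. Qed.
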